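(* Let $q\ge1$, $n>q$, $m\ge q+1$ and $d>q$ be integers, and let $\mathbf d=(d_1,\dots,d_m)$ be a vector of positive integers with $\sum_id_i=d$. Let $\lambda\in Gr(q,\mathbb C^m)$ be such that $i_{\mathbf d}(\lambda)=0$, and let $(F_i)_{i=1}^m\in\prod_{i=1}^mS_{d_i}$. Then the logarithmic $q$-form of type $\mathbf d$ $$\omega=\sum_{|I|=q}\lambda_I\hat F_I\,dF_I$$ is a twisted projective form of total degree $d$, i.e. $\omega\in H^0(\mathbb P^n,\Omega^q_{\mathbb P^n}(d))$, and it satisfies $$i_v(\omega)\wedge\omega=0\quad\text{and}\quad i_v(\omega)\wedge d\omega=0\qquad\text{for all }v\in\bigwedge\nolimits^{q-1}\mathbb C^{n+1}.$$ Hence $[\omega]\in\mathcal F_q(d,\mathbb P^n)$.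
   Context: Everything is over $\mathbb C$. $S_e$ is the space of homogeneous polynomials of degree $e$ in $\mathbb C[x_0,\dots,x_n]$. For $I=\{i_1<\dots<i_q\}\subset\{1,\dots,m\}$: $\hat F_I=\prod_{j\notin I}F_j$, $dF_I=dF_{i_1}\wedge\dots\wedge dF_{i_q}$. $Gr(q,\mathbb C^m)$ is the Grassmannian of $q$-dimensional subspaces of $\mathbb C^m$, embedded in $\mathbb P(\bigwedge^q\mathbb C^m)$ by Plücker; by abuse of notation its elements are written $\lambda=\lambda^1\wedge\dots\wedge\lambda^q$, with antisymmetric coordinates $\lambda_I$. $i_{\mathbf d}:\bigwedge^q\mathbb C^m\to\bigwedge^{q-1}\mathbb C^m$ is the interior product by $\mathbf d$: $i_{\mathbf d}(e_{i_1}\wedge\dots\wedge e_{i_q})=\sum_j(-1)^{j+1}d_{i_j}e_{i_1}\wedge\dots\wedge\widehat{e_{i_j}}\wedge\dots\wedge e_{i_q}$. Elements of $H^0(\mathbb P^n,\Omega^q_{\mathbb P^n}(d))$ are identified with polynomial $q$-forms on $\mathbb C^{n+1}$ with coefficients in $S_{d-q}$ annihilated by contraction with the Euler field $R=\sum_ix_i\frac{\partial}{\partial x_i}$. $\mathcal F_q(d,\mathbb P^n)$, the space of codimension $q$ singular foliations on $\mathbb P^n$ of degree $d$, is the set of classes $[\omega]\in\mathbb PH^0(\mathbb P^n,\Omega^q_{\mathbb P^n}(d))$ such that $i_v(\omega)\wedge\omega=0$ and $i_v(\omega)\wedge d\omega=0$ for all $v\in\bigwedge^{q-1}\mathbb C^{n+1}$,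 and $\operatorname{codim}(S_\omega)\ge2$, where $S_\omega=\{p\in\mathbb P^n:\omega(p)=0\}$.
   Formalization: The final membership of [ω] in F_q(d,P^n) is stated only when codim(S_ω) ≥ 2, a condition in the definition of F_q(d,P^n) that fails for some F_i (e.g. all F_i = 0, where ω = 0); the other conclusions are unconditional. *)

(* Defs.v *)
(* In statements, the complex numbers are R[i] for R : realType. *)
From HB Require Import structures.
From mathcomp Require Import all_boot all_order all_algebra.
From mathcomp Require Import classical_sets reals complex.
From mathcomp Require Export mpoly.
Export GRing.Theory.

Set Implicit Arguments.
Unset Strict Implicit.
Unset Printing Implicit Defensive.

Local Open Scope ring_scope.

(* The exterior algebra of the free module A^n: an element is the family of
   its coordinates on the basis e_J = e_{j_1} /\ ... /\ e_{j_k},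
   J = {j_1 < ... < j_k}. *)
Notation ext A n := {ffun {set 'I_n} -> A^o}.

Section Exterior.
Variables (A : comNzRingType) (n : nat).
Implicit Types (a b : ext A n) (J L : {set 'I_n}).

Definition ext_base J : ext A n := [ffun L => (L == J)%:R].

Definition ext1 : ext A n := ext_base finset.set0.

Definition vec_ext (u : 'rV[A]_n) : ext A n :=
  \sum_(i < n) u 0 i *: ext_base [set i].

Definition ext_degree (q : nat) a := forall J, a J != 0 -> #|J| = q.

(* The number of transpositions needed to sort J followed by L. *)
Definition inversions J L : nat :=
  #|[set p : 'I_n * 'I_n | [&& p.1 \in J, p.2 \in L & p.2 < p.1]%N]|.

Definition wedge a b : ext A n :=
  \sum_(J : {set 'I_n}) \sum_(L : {set 'I_n} | [disjoint J & L])
    ((-1) ^+ inversions J L * a J * b L) *: ext_base (J :|: L).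

(* i_t(e_{j_1} /\ ... /\ e_{j_k})
   = sum_s (-1)^{s+1} t_{j_s} e_{j_1} /\ .. omit e_{j_s} .. /\ e_{j_k} *)
Definition interior (t : 'I_n -> A) a : ext A n :=
  \sum_(J : {set 'I_n}) \sum_(i in J)
    ((-1) ^+ #|[set j in J | (j < i)%N]| * t i * a J) *: ext_base (J :\ i).

End Exterior.

Arguments ext1 {A n}.
Arguments ext_base {A n} J.

(* Polynomial differential forms on affine n-space: e_J stands for dx_J. *)
Notation form K n := (ext {mpoly K[n]} n).

Section Forms.
Variables (K : fieldType) (n : nat).
Implicit Types (f : {mpoly K[n]}) (w : form K n) (v : ext K n).

Definition dfun f : form K n := \sum_(i < n) f^`M(i) *: ext_base [set i].

Definition dform w : form K n :=
  \sum_(J : {set 'I_n}) wedge (dfun (w J)) (ext_base J).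

(* Contraction with a constant multivector, normalised by
   i_{u_1 /\ ... /\ u_p} w = w(u_1, ..., u_p, -). *)
Definition contract v w : form K n :=
  \sum_(L : {set 'I_n}) (v L)%:MP *:
    foldl (fun a l => interior (fun i => (i == l)%:R) a) w (enum L).

End Forms.

(* The Grassmannian of q-dimensional subspaces of K^m. *)
Definition Gr (K : fieldType) (q m : nat) :=
  {W : {vspace 'rV[K]_m} | \dim W == q}.

(* lam is a vector representing the image of W under the Pluecker embedding,
   i.e. the wedge of some basis of W (any nonzero multiple of a
   representative is again one when q > 0). *)
Definition plucker (K : fieldType) (q m : nat) (W : Gr K q m) (lam : ext K m) :=
  exists2 b : q.-tuple 'rV[K]_m, basis_of (val W) b &
    lam = \big[@wedge K m/ext1]_(u <- b) vec_ext u.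

Definition proj_space (K : fieldType) (n : nat) := Gr K 1 n.+1.

Section Projective.
Variables (K : fieldType) (n : nat).
Implicit Types (p : proj_space K n) (Y Z : set (proj_space K n)).

Definition vanishes (f : {mpoly K[n.+1]}) p :=
  forall u : 'rV[K]_n.+1, u \in val p -> u != 0 -> f.@[fun i => u 0 i] = 0.

Definition zariski_closed Z :=
  exists2 T : set {mpoly K[n.+1]},
    (forall f, T f -> exists e : nat, f \is e.-homog) &
    Z = [set p | forall f, T f -> vanishes f p]%classic.

Definition irreducible_closed Y :=
  [/\ zariski_closed Y, (Y !=set0)%classic &
      forall Y1 Y2, zariski_closed Y1 -> zariski_closed Y2 ->
        (Y `<=` Y1 `|` Y2)%classic -> (Y `<=` Y1)%classic \/ (Y `<=` Y2)%classic].

(* codim Z >= k, where codim Z is the infimum, over the irreducible closed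
   Y contained in Z, of the supremum of the lengths of the chains
   Y = c_0 < c_1 < ... of irreducible closed subsets of P^n; in particular
   the empty set has infinite codimension. *)
Definition codim_ge (k : nat) Z :=
  forall Y, irreducible_closed Y -> (Y `<=` Z)%classic ->
    exists c : nat -> set (proj_space K n),
      [/\ c 0%N = Y,
          forall i, (i <= k)%N -> irreducible_closed (c i) &
          forall i, (i < k)%N -> (c i `<` c i.+1)%classic].

(* H^0(P^n, Omega^q(d)), to be used for q <= d (the difference d - q is
   truncated). *)
Definition twisted_form (q d : nat) (w : form K n.+1) :=
  [/\ ext_degree q w,
      forall J, (w J : {mpoly K[n.+1]}) \is (d - q).-homog &
      interior (fun i => 'X_i) w = 0].

Definition foliation_equations (q : nat) (w : form K n.+1) :=
  forall v : ext K n.+1, ext_degree q.-1 v ->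
    wedge (contract v w) w = 0 /\ wedge (contract v w) (dform w) = 0.

Definition sing (w : form K n.+1) : set (proj_space K n) :=
  [set p | forall J, vanishes (w J) p]%classic.

Definition proj_class (w : form K n.+1) : set (form K n.+1) :=
  [set eta | exists2 c : K, c != 0 & eta = c%:MP *: w]%classic.

(* The space F_q(d, P^n), as a set of classes in P H^0(P^n, Omega^q(d)). *)
Definition foliations (q d : nat) : set (set (form K n.+1)) :=
  [set L | exists w : form K n.+1,
     [/\ w != 0 /\ L = proj_class w, twisted_form q d w,
         foliation_equations q w & codim_ge 2 (sing w)]]%classic.

(* The bigop over i in I runs through I in increasing order, so it is
   dF_{i_1} /\ ... /\ dF_{i_q}. *)
Definition log_form (q m : nat) (lam : ext K m) (F : 'I_m -> {mpoly K[n.+1]}) :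
    form K n.+1 :=
  \sum_(I : {set 'I_m} | #|I| == q)
    ((lam I)%:MP * \prod_(j | j \notin I) F j) *:
      \big[@wedge {mpoly K[n.+1]} n.+1/ext1]_(i in I) dfun (F i).

End Projective.

Arguments foliations K n q d : clear implicits.

(* Main.v *)
(* If some F_i is 0 then dF_i is 0 too, and w = 0. Otherwise let F be the product
   of the F_i. The algebra map phi sending e_i to F dF_i / F_i satisfies
   F^q w = F phi(lam), and phi(lam) is a wedge of q one-forms because lam is
   decomposable. Contracting it with a (q-1)-vector gives a combination of these
   one-forms, each of which kills phi(lam); this is the first equation, after
   cancelling F. The second one follows from F dw = dF /\ w. By Euler's identity
   i_R phi(lam) = F phi(i_d lam) = 0, whence i_R w = 0.
   Finally w <> 0 when sing w has codimension at least 2, as P^n is irreducible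
   and no irreducible closed subset properly contains it. *)

Require Import Defs.
From HB Require Import structures.
From mathcomp Require Import all_boot all_order all_algebra.
From mathcomp Require Import boolp classical_sets reals complex.
(* classical_sets shadows set0, setIUl, ... *)
Import mathcomp.boot.finset.

Set Implicit Arguments.
Unset Strict Implicit.
Unset Printing Implicit Defensive.

Local Open Scope ring_scope.

(** * Exterior algebra *)

Section ExteriorTheory.
Variables (A : comNzRingType) (n : nat).
Implicit Types (a b c : ext A n) (J L M : {set 'I_n}) (u : 'rV[A]_n).
Implicit Types (t : 'I_n -> A).

(** Extending the sign by 0 to overlapping index sets turns [wedge] into a sum over all pairs,
    without side conditions. *)
Definition wedge_sign J L : A :=
  if [disjoint J & L] then (-1) ^+ inversions J L else 0.

Lemma wedgeE a b :
  wedge a b = \sum_J \sum_L (wedge_sign J L * a J * b L) *: ext_base (J :|: L).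
Proof.
apply: eq_bigr => J _; rewrite big_mkcond; apply: eq_bigr => L _.
by rewrite /wedge_sign; case: ifP => // _; rewrite !mul0r scale0r.
Qed.

Lemma ext_baseE a : a = \sum_J a J *: ext_base J.
Proof.
apply/ffunP => M; rewrite sum_ffunE (bigD1 M) //= !ffunE eqxx.
rewrite big1 ?addr0 => [|J neJ]; first by rewrite /GRing.scale /= mulr1.
by rewrite !ffunE eq_sym (negbTE neJ) scaler0.
Qed.

Lemma wedge_is_linear_l b : linear (fun a => wedge a b).
Proof.
move=> k a1 a2; rewrite !wedgeE scaler_sumr -big_split; apply: eq_bigr => J _.
rewrite scaler_sumr -big_split; apply: eq_bigr => L _ /=.
by rewrite !ffunE scalerA -scalerDl mulrDr mulrDl mulrCA -!mulrA.
Qed.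

Lemma wedge_is_linear_r a : linear (wedge a).
Proof.
move=> k b1 b2; rewrite !wedgeE scaler_sumr -big_split; apply: eq_bigr => J _.
rewrite scaler_sumr -big_split; apply: eq_bigr => L _ /=.
by rewrite !ffunE scalerA -scalerDl mulrDr mulrCA.
Qed.

HB.instance Definition _ a :=
  GRing.isLinear.Build A (ext A n) (ext A n) *:%R (wedge a) (wedge_is_linear_r a).

Definition wedger b a := wedge a b.

HB.instance Definition _ b :=
  GRing.isLinear.Build A (ext A n) (ext A n) *:%R (wedger b) (wedge_is_linear_l b).

Lemma wedgeDl a1 a2 b : wedge (a1 + a2) b = wedge a1 b + wedge a2 b.
Proof. exact: (linearD (wedger b)). Qed.

Lemma wedgeZl k a b : wedge (k *: a) b = k *: wedge a b.
Proof. exact: (linearZZ (wedger b)). Qed.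

Lemma wedgeZr k a b : wedge a (k *: b) = k *: wedge a b.
Proof. exact: (linearZZ (wedge a)). Qed.

Lemma wedge0l b : wedge 0 b = 0.
Proof. exact: (linear0 (wedger b)). Qed.

Lemma wedgeNl a b : wedge (- a) b = - wedge a b.
Proof. exact: (linearN (wedger b)). Qed.

Lemma wedge_suml I (r : seq I) P (f : I -> ext A n) b :
  wedge (\sum_(i <- r | P i) f i) b = \sum_(i <- r | P i) wedge (f i) b.
Proof. exact: (linear_sum (wedger b)). Qed.

Lemma wedge_comb0 k1 k2 a1 a2 b : wedge a1 b = 0 -> wedge a2 b = 0 ->
  wedge (k1 *: a1 + k2 *: a2) b = 0.
Proof.
by move=> a1b a2b; rewrite wedgeDl !wedgeZl a1b a2b !scaler0 addr0.
Qed.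

Lemma wedge_comb_scale k1 k2 l a1 a2 b : wedge a2 b = 0 ->
  (k1 * k2) *: wedge (l *: a1) b = wedge (k1 *: a1 + k2 *: a2) ((l * k2) *: b).
Proof.
move=> a2b; rewrite wedgeDl !wedgeZl !wedgeZr /= a2b !scaler0 addr0.
by rewrite !scalerA -mulrA [k2 * l]mulrC.
Qed.

Lemma wedge_sumr I (r : seq I) P (f : I -> ext A n) a :
  wedge a (\sum_(i <- r | P i) f i) = \sum_(i <- r | P i) wedge a (f i).
Proof. exact: (linear_sum (wedge a)). Qed.

Lemma wedge_base J L :
  wedge (ext_base J) (ext_base L) = wedge_sign J L *: ext_base (J :|: L).
Proof.
rewrite wedgeE (bigD1 J) //= (bigD1 L) //= big1 => [|L' neL]; last first.
  by rewrite !ffunE (negbTE neL) mulr0 scale0r.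
rewrite big1 => [|J' neJ]; last first.
  by apply: big1 => L' _; rewrite !ffunE (negbTE neJ) mulr0 mul0r scale0r.
by rewrite !ffunE !eqxx !mulr1 !addr0.
Qed.

Lemma inversionsUl J L M : [disjoint J & L] ->
  inversions (J :|: L) M = (inversions J M + inversions L M)%N.
Proof.
move=> dJL; rewrite /inversions -cardsUI.
rewrite [X in (_ + X)%N](_ : _ = 0%N) ?addn0; last first.
  apply/eqP; rewrite cards_eq0; apply/eqP/setP => -[i j]; rewrite !inE /=.
  by case: (boolP (i \in J)) => // iJ; rewrite (disjointFr dJL iJ) andbF.
by congr #|pred_of_set _|; apply/setP => -[i j]; rewrite !inE /= -andb_orl.
Qed.

Lemma inversionsUr J L M : [disjoint L & M] ->
  inversions J (L :|: M) = (inversions J L + inversions J M)%N.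
Proof.
move=> dLM; rewrite /inversions -cardsUI.
rewrite [X in (_ + X)%N](_ : _ = 0%N) ?addn0; last first.
  apply/eqP; rewrite cards_eq0; apply/eqP/setP => -[i j]; rewrite !inE /=.
  by case: (boolP (j \in L)) => [jL|_]; rewrite ?(disjointFr dLM jL) !andbF.
congr #|pred_of_set _|; apply/setP => -[i j]; rewrite !inE /=.
by rewrite -andb_orr -andb_orl.
Qed.

(** This is associativity on basis vectors. Both sides vanish unless [J], [L], [M] are pairwise
    disjoint, and then both exponents count the inversions of the three pairs. *)
Lemma wedge_signA J L M :
  wedge_sign J L * wedge_sign (J :|: L) M
    = wedge_sign L M * wedge_sign J (L :|: M).
Proof.
have dU1 : [disjoint J :|: L & M] = [disjoint J & M] && [disjoint L & M].
  by rewrite -!setI_eq0 setIUl setU_eq0.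
have dU2 : [disjoint J & L :|: M] = [disjoint J & L] && [disjoint J & M].
  by rewrite -!setI_eq0 setIUr setU_eq0.
rewrite /wedge_sign dU1 dU2.
case: (boolP [disjoint J & L]) => dJL; last by rewrite mul0r mulr0.
case: (boolP [disjoint L & M]) => dLM; last by rewrite andbF mul0r mulr0.
rewrite andbT; case: ifP => _; last by rewrite !mulr0.
by rewrite inversionsUl // inversionsUr // -!exprD addnA addnC addnA.
Qed.

Lemma eq_ext_base m (f g : {linear ext A n -> ext A m}) :
  (forall J, f (ext_base J) = g (ext_base J)) -> f =1 g.
Proof.
move=> eq_fg a; rewrite [a]ext_baseE !linear_sum; apply: eq_bigr => J _.
by rewrite !linearZ /= eq_fg.
Qed.

Lemma wedgeA a b c : wedge a (wedge b c) = wedge (wedge a b) c.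
Proof.
(* Linear maps are compared on the basis in one argument at a time, three times. *)
apply: (eq_ext_base (f := wedger (wedge b c))
                    (g := wedger c \o wedger b)) a => J /=.
apply: (eq_ext_base (f := wedge (ext_base J) \o wedger c)
                    (g := wedger c \o wedge (ext_base J))) b => L /=.
apply: (eq_ext_base (f := wedge (ext_base J) \o wedge (ext_base L))
                    (g := wedge (wedge (ext_base J) (ext_base L)))) c => M /=.
rewrite !wedge_base linearZ wedgeZl /= !wedge_base.
by rewrite !scalerA setUA wedge_signA mulrC.
Qed.

(** * Signs of single insertions and antisymmetry of vectors *)

Definition below (i : 'I_n) J := #|[set j in J | (j < i)%N]|.

Lemma belowU1 i j J : j \notin J -> below i (j |: J) = ((j < i) + below i J)%N.
Proof.
move=> jJ; rewrite /below; case: ltnP => ji.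
  have -> : [set k in j |: J | (k < i)%N] = j |: [set k in J | (k < i)%N].
    by apply/setP => k; rewrite !inE; case: eqVneq => // ->; rewrite ji.
  by rewrite cardsU1 inE (negbTE jJ).
congr #|pred_of_set _|; apply/setP => k; rewrite !inE.
by case: eqVneq => // ->; rewrite ltnNge ji !andbF.
Qed.

Lemma belowD1 i j J : j \in J -> below i J = ((j < i) + below i (J :\ j))%N.
Proof. by move=> jJ; rewrite -{1}(setD1K jJ) belowU1 // !inE eqxx. Qed.

Lemma below_set1 i j : below i [set j] = (j < i)%N.
Proof.
rewrite -[[set j]](setU0 [set j]) belowU1 ?inE // /below.
rewrite (_ : [set _ | _] = set0) ?cards0 ?addn0 //.
by apply/setP => k; rewrite !inE.
Qed.

Let inj_pair1 (i : 'I_n) : injective (fun j : 'I_n => (i, j)).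
Proof. by move=> j k []. Qed.

(** Putting [i] in front of [J] costs one transposition per smaller element of [J]; [below] is also
    the exponent in [interior]. *)
Lemma wedge_sign1 i J : wedge_sign [set i] J =
  if i \in J then 0 else (-1) ^+ below i J.
Proof.
rewrite /wedge_sign disjoints1 if_neg; case: ifP => // _; congr ((-1) ^+ _).
rewrite /inversions /below -(card_imset _ (@inj_pair1 i)).
congr #|pred_of_set _|; apply/setP => -[i' j]; rewrite !inE /=.
apply/and3P/imsetP => [[/eqP-> jJ ji]|[k]].
  by exists j => //; rewrite inE jJ.
by rewrite inE => /andP[kJ ki] [-> ->].
Qed.

Lemma wedge1l a : wedge ext1 a = a.
Proof.
apply: (eq_ext_base (f := wedge ext1) (g := idfun)) a => J /=.
rewrite wedge_base set0U /wedge_sign -setI_eq0 set0I eqxx.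
rewrite /inversions (_ : [set _ | _] = set0) ?cards0 ?scale1r //.
by apply/setP => x; rewrite !inE.
Qed.

Lemma wedge_base1_base1 i :
  wedge (ext_base [set i]) (ext_base [set i]) = 0 :> ext A n.
Proof. by rewrite wedge_base wedge_sign1 inE eqxx scale0r. Qed.

Lemma wedge_base1_anti i j :
  wedge (ext_base [set i]) (ext_base [set j])
    = - wedge (ext_base [set j]) (ext_base [set i]) :> ext A n.
Proof.
case: (eqVneq i j) => [->|nij]; first by rewrite wedge_base1_base1 oppr0.
rewrite !wedge_base !wedge_sign1 !inE (negbTE nij) eq_sym (negbTE nij).
rewrite !below_set1 setUC.
rewrite -scaleNr; apply: (congr1 (fun k : A => k *: (_ : ext A n))).
case: (ltngtP i j) => [_|_|/val_inj eij]; rewrite ?expr0 ?expr1 ?opprK //.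
by rewrite eij eqxx in nij.
Qed.

Lemma wedge_vecl u a :
  wedge (vec_ext u) a = \sum_i u 0 i *: wedge (ext_base [set i]) a.
Proof. by rewrite wedge_suml; apply: eq_bigr => i _; rewrite wedgeZl. Qed.

Lemma wedge_vecr u a :
  wedge a (vec_ext u) = \sum_i u 0 i *: wedge a (ext_base [set i]).
Proof.
rewrite wedge_sumr.
by apply: eq_bigr => i _; rewrite (linearZZ (wedge a)).
Qed.

Lemma wedge_vec_anti u1 u2 :
  wedge (vec_ext u1) (vec_ext u2) = - wedge (vec_ext u2) (vec_ext u1).
Proof.
rewrite wedge_vecl wedge_vecr -sumrN; apply: eq_bigr => i _ /=.
rewrite wedge_vecl wedge_vecr -scalerN -sumrN.
apply: (congr1 ( *:%R _)); apply: eq_bigr => j _.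
by rewrite wedge_base1_anti scalerN.
Qed.

(** With [b i] and [c i] the partial derivatives of [vec_ext u] and [a], this is the Leibniz rule
    for d; the minus sign comes from moving e_i past [vec_ext u]. *)
Lemma sum_base1_leibniz (b c : 'I_n -> ext A n) u a :
  \sum_i wedge (ext_base [set i]) (wedge (b i) a + wedge (vec_ext u) (c i))
    = wedge (\sum_i wedge (ext_base [set i]) (b i)) a
      - wedge (vec_ext u) (\sum_i wedge (ext_base [set i]) (c i)).
Proof.
rewrite wedge_suml wedge_sumr -sumrB.
apply: eq_bigr => i _; rewrite linearD /= !wedgeA -wedgeNl.
congr (_ + wedge _ _); rewrite wedge_vecl wedge_vecr -sumrN.
by apply: eq_bigr => j _; rewrite wedge_base1_anti scalerN.
Qed.

(** The terms at (i, j) and (j, i) cancel. The diagonal is a separate hypothesis because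
    antisymmetry alone gives only 2 s_ii = 0. *)
Lemma sum_alternating (V : zmodType) (s : 'I_n -> 'I_n -> V) :
  (forall i, s i i = 0) -> (forall i j, s j i = - s i j) ->
  \sum_(i < n) \sum_(j < n) s i j = 0.
Proof.
move=> s0 sN.
have -> : \sum_i \sum_j s i j = \sum_(i < n) \sum_(j < n | (i < j)%N) s i j
                              + \sum_(i < n) \sum_(j < n | (j < i)%N) s i j.
  rewrite -big_split; apply: eq_bigr => i _.
  rewrite (bigID (fun j : 'I_n => i < j)%N) /=; congr (_ + _).
  rewrite (bigD1 i) ?ltnn //= s0 add0r.
  apply: eq_bigl => j; rewrite -leqNgt andbC [RHS]ltn_neqAle.
  by rewrite -(inj_eq val_inj).
rewrite [X in _ + X](exchange_big_dep xpredT) //= -big_split big1 //= => i _.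
by rewrite -big_split big1 //= => j _; rewrite (sN i j) addrN.
Qed.

Lemma wedge_vec_vec u : wedge (vec_ext u) (vec_ext u) = 0.
Proof.
rewrite wedge_vecl; under eq_bigr => i _ do rewrite wedge_vecr scaler_sumr.
apply: sum_alternating => [i|i j].
  by rewrite wedge_base1_base1 !scaler0.
by rewrite wedge_base1_anti !scalerN !scalerA mulrC.
Qed.

(** * The interior product as an antiderivation *)

Lemma interior_is_linear t : linear (@interior A n t).
Proof.
move=> k a b; rewrite /interior scaler_sumr -big_split; apply: eq_bigr => J _.
rewrite scaler_sumr -big_split; apply: eq_bigr => L _ /=.
by rewrite !ffunE scalerA -scalerDl mulrDr mulrCA.
Qed.

HB.instance Definition _ (t : 'I_n -> A) :=
  GRing.isLinear.Build A (ext A n) (ext A n) *:%R (@interior A n t)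
    (interior_is_linear t).

Lemma interiorZ t k a : interior t (k *: a) = k *: interior t a.
Proof. exact: (linearZZ (interior t)). Qed.

Lemma interior_base t J :
  interior t (ext_base J) =
    \sum_(i in J) ((-1) ^+ below i J * t i) *: ext_base (J :\ i).
Proof.
rewrite /interior (bigD1 J) //= [X in _ + X]big1 => [|L neL].
  by rewrite addr0; apply: eq_bigr => i _; rewrite ffunE eqxx mulr1.
by apply: big1 => i _; rewrite ffunE (negbTE neL) mulr0 scale0r.
Qed.

(** If [i] is in [J], the left side is 0 and on the right only the removal of [i] survives,
    cancelling the first term. Otherwise removing [i] gives the first term, and the removals of the
    other indices match up to sign. *)
Lemma interior_wedge_base t i J :
  interior t (wedge (ext_base [set i]) (ext_base J)) =
    t i *: ext_base J - wedge (ext_base [set i]) (interior t (ext_base J)).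
Proof.
have wE : wedge (ext_base [set i]) (interior t (ext_base J)) =
  \sum_(j in J) ((-1) ^+ below j J * t j *
      (if i \in J :\ j then 0 else (-1) ^+ below i (J :\ j))) *:
    ext_base (i |: (J :\ j)).
  rewrite interior_base linear_sum; apply: eq_bigr => j _.
  by rewrite linearZ /= wedge_base wedge_sign1 scalerA.
rewrite wedge_base wedge_sign1 {}wE linearZ /=.
case: (boolP (i \in J)) => iJ.
  rewrite scale0r (bigD1 i) //= !inE eqxx /= setD1K // big1 => [|j /andP[jJ nij]].
    rewrite (belowD1 _ iJ) ltnn mulrAC -expr2 sqrr_sign mul1r addr0.
    by rewrite subrr.
  by rewrite !inE eq_sym nij iJ mulr0 scale0r.
rewrite interior_base big_setU1 //= scalerDr setU1K // scalerA mulrA.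
rewrite belowU1 // ltnn -expr2 sqrr_sign mul1r; congr (_ + _).
rewrite scaler_sumr -sumrN; apply: eq_bigr => j jJ.
have nji : j != i by apply: contraNneq iJ => <-.
rewrite !inE (negbTE iJ) andbF scalerA -scaleNr.
have -> : (i |: J) :\ j = i |: J :\ j.
  apply/setP => k; rewrite !inE; case: (eqVneq k j) => //= ->.
  by rewrite (negbTE nji).
apply: (congr1 (fun k : A => k *: (_ : ext A n))).
rewrite (belowD1 i jJ) belowU1 // mulrA -exprD mulrAC -exprD -mulNr.
congr (_ * _); rewrite -signr_odd -[in RHS]signr_odd !oddD.
(* Exactly one of i < j and j < i holds, so inserting [i] and removing [j] in the two orders gives
   opposite signs. *)
have -> : odd (i < j)%N = ~~ odd (j < i)%N.
  by case: (ltngtP i j) => // /val_inj eij; rewrite eij eqxx in nji.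
by case: (odd (j < i)%N); case: (odd _); case: (odd _);
  rewrite /= ?expr0 ?expr1 ?opprK.
Qed.

Lemma interior_vec_wedge t u a :
  interior t (wedge (vec_ext u) a) =
    (\sum_i u 0 i * t i) *: a - wedge (vec_ext u) (interior t a).
Proof.
rewrite !wedge_vecl linear_sum scaler_suml -sumrB; apply: eq_bigr => i _.
rewrite linearZ -scalerA -scalerBr.
apply: (congr1 ( *:%R _)).
apply: (eq_ext_base (f := interior t \o wedge (ext_base [set i]))
   (g := GRing.sub_fun ( *:%R (t i))
     (wedge (ext_base [set i]) \o interior t))) a => J.
exact: interior_wedge_base.
Qed.

End ExteriorTheory.

(** * Products of vectors, their degrees and their spans *)

Section WedgeProducts.
Variables (A : comNzRingType) (n : nat).
Implicit Types (a b c : ext A n) (J L M : {set 'I_n}) (u v : 'rV[A]_n).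
Implicit Types (t : 'I_n -> A).

Lemma vec_ext_is_linear : linear (@vec_ext A n).
Proof.
move=> k u v; rewrite scaler_sumr -big_split; apply: eq_bigr => i _ /=.
by rewrite !mxE scalerDl scalerA.
Qed.

HB.instance Definition _ :=
  GRing.isLinear.Build A 'rV[A]_n (ext A n) *:%R (@vec_ext A n)
    vec_ext_is_linear.

Lemma wedge_vecCA u v a :
  wedge (vec_ext u) (wedge (vec_ext v) a)
    = - wedge (vec_ext v) (wedge (vec_ext u) a).
Proof. by rewrite !wedgeA wedge_vec_anti wedgeNl. Qed.

Lemma wedge_vec_vecA u a : wedge (vec_ext u) (wedge (vec_ext u) a) = 0.
Proof. by rewrite wedgeA wedge_vec_vec wedge0l. Qed.

Lemma wedge_vec_wedge0 u v a : wedge (vec_ext u) a = 0 ->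
  wedge (vec_ext u) (wedge (vec_ext v) a) = 0.
Proof. by rewrite wedge_vecCA => ->; rewrite linear0 oppr0. Qed.

Lemma interior_ext1 t : interior t ext1 = 0.
Proof. by rewrite interior_base big_set0. Qed.

Lemma wedge_vec_big u (s : seq 'rV[A]_n) : u \in s ->
  wedge (vec_ext u) (\big[@wedge A n/ext1]_(v <- s) vec_ext v) = 0.
Proof.
elim: s => // v s IHs; rewrite inE big_cons; case: eqVneq => [-> _|_ /IHs IH].
  exact: wedge_vec_vecA.
by rewrite wedge_vecCA IH linear0 oppr0.
Qed.

Lemma ext_degreeZ_base q (k : A) J :
  (k != 0 -> #|J| = q) -> ext_degree q (k *: ext_base J : ext A n).
Proof.
move=> degJ L; rewrite !ffunE; case: (eqVneq L J) => [->|_] /=; last first.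
  by rewrite scaler0 eqxx.
by rewrite /GRing.scale /= mulr1.
Qed.

Lemma ext_degree_sum q I (r : seq I) (P : pred I) (f : I -> ext A n) :
  (forall i, P i -> ext_degree q (f i)) ->
  ext_degree q (\sum_(i <- r | P i) f i).
Proof.
move=> degf J; apply: contra_neq_eq => neJ; rewrite sum_ffunE big1 // => i Pi.
by apply/eqP; apply: contraNT neJ => nz; apply/eqP; apply: degf Pi _ nz.
Qed.

Lemma ext_degreeZ q (k : A) a : ext_degree q a -> ext_degree q (k *: a).
Proof.
move=> dega J; rewrite ffunE => nz; apply: dega.
by apply: contraNneq nz => ->; rewrite scaler0.
Qed.

Lemma ext_degree_wedge p q a b :
  ext_degree p a -> ext_degree q b -> ext_degree (p + q) (wedge a b).
Proof.
move=> dega degb; apply: ext_degree_sum => J _; apply: ext_degree_sum => L dJL.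
apply: ext_degreeZ_base => nz; rewrite cardsU.
rewrite (eqP (_ : J :&: L == set0)) ?setI_eq0 //.
rewrite cards0 subn0 dega ?degb //; apply: contraNneq nz => ->.
  by rewrite mulr0.
by rewrite mulr0 mul0r.
Qed.

Lemma ext_degree_vec u : ext_degree 1 (vec_ext u).
Proof.
by apply: ext_degree_sum => i _; apply: ext_degreeZ_base; rewrite cards1.
Qed.

Lemma ext_degree_big (I : Type) (s : seq I) (P : pred I) (f : I -> 'rV[A]_n) :
  ext_degree (count P s) (\big[@wedge A n/ext1]_(i <- s | P i) vec_ext (f i)).
Proof.
elim: s => [|i s IHs]; rewrite ?big_nil ?big_cons /=.
  by rewrite -[ext1]scale1r; apply: ext_degreeZ_base; rewrite cards0.
by case: (P i) => //; apply: ext_degree_wedge => //; apply: ext_degree_vec.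
Qed.

Lemma big_wedgeZ (I : Type) (s : seq I) (P : pred I) (h : I -> A)
    (v : I -> 'rV[A]_n) :
  \big[@wedge A n/ext1]_(i <- s | P i) vec_ext (h i *: v i)
  = (\prod_(i <- s | P i) h i) *:
      \big[@wedge A n/ext1]_(i <- s | P i) vec_ext (v i).
Proof.
elim: s => [|i s IHs]; first by rewrite !big_nil scale1r.
rewrite !big_cons; case: (P i); last exact: IHs.
rewrite IHs (linearZZ (@vec_ext A n)) wedgeZl wedgeZr.
by rewrite scalerA.
Qed.

Lemma big_wedge0 (I : eqType) (s : seq I) (P : pred I) (v : I -> 'rV[A]_n) i :
  i \in s -> P i -> v i = 0 ->
  \big[@wedge A n/ext1]_(j <- s | P j) vec_ext (v j) = 0.
Proof.
move=> + Pi vi0; elim: s => // j s IHs; rewrite inE big_cons.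
case: eqVneq => [<- _|_ /= /IHs->]; last by rewrite linear0 if_same.
by rewrite Pi vi0 (linear0 (@vec_ext A n)) wedge0l.
Qed.

(** The combinations of [p]-fold products of vectors in [S]. Recording the number of factors allows
    them to be followed through successive contractions. *)
Inductive wedge_span (S : 'rV[A]_n -> Prop) : nat -> ext A n -> Prop :=
| wedge_span0 k : wedge_span S 0 (k *: ext1)
| wedge_spanS p u a :
    S u -> wedge_span S p a -> wedge_span S p.+1 (wedge (vec_ext u) a)
| wedge_spanD p a b :
    wedge_span S p a -> wedge_span S p b -> wedge_span S p (a + b)
| wedge_span_zero p : wedge_span S p 0.

Lemma wedge_spanZ S p k a : wedge_span S p a -> wedge_span S p (k *: a).
Proof.
elim=> {p a} [l|p u a Su _ IHa|p a b _ IHa _ IHb|p].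
- by rewrite scalerA; apply: wedge_span0.
- by rewrite -wedgeZr; apply: wedge_spanS.
- by rewrite scalerDr; apply: wedge_spanD.
- by rewrite scaler0; apply: wedge_span_zero.
Qed.

Lemma wedge_span_sum S p I (r : seq I) (P : pred I) (f : I -> ext A n) :
  (forall i, P i -> wedge_span S p (f i)) ->
  wedge_span S p (\sum_(i <- r | P i) f i).
Proof.
by move=> Sf; apply: big_ind => //; [apply: wedge_span_zero|apply: wedge_spanD].
Qed.

Lemma wedge_span_big (S : 'rV[A]_n -> Prop) (s : seq 'rV[A]_n) :
  (forall u, u \in s -> S u) ->
  wedge_span S (size s) (\big[@wedge A n/ext1]_(u <- s) vec_ext u).
Proof.
elim: s => [|u s IHs] Ss; rewrite ?big_nil ?big_cons /=.
  by rewrite -[ext1]scale1r; apply: wedge_span0.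
apply: wedge_spanS; first by apply: Ss; rewrite inE eqxx.
by apply: IHs => v sv; apply: Ss; rewrite inE sv orbT.
Qed.

(** By the antiderivation rule, contraction deletes one factor in each term; scalars are sent to
    0. *)
Lemma wedge_span_interior S t p a : wedge_span S p a ->
  if p is p'.+1 then wedge_span S p' (interior t a) else interior t a = 0.
Proof.
elim=> {p a} [l|p u a Su Sa IHa|p a b _ IHa _ IHb|p].
- by rewrite linearZ /= interior_ext1 scaler0.
- rewrite interior_vec_wedge; apply: wedge_spanD; first exact: wedge_spanZ.
  rewrite -scaleN1r; apply: wedge_spanZ.
  case: p Sa IHa => [_ ->|p _]; last exact: wedge_spanS.
  by rewrite linear0; apply: wedge_span_zero.
- rewrite linearD /=; case: p IHa IHb => [-> ->|p]; first by rewrite addr0.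
  exact: wedge_spanD.
- by rewrite linear0; case: p => // p; apply: wedge_span_zero.
Qed.

(** Every term has at least one factor from [S], and the last such factor annihilates [b]. *)
Lemma wedge_span_wedge0 (S : 'rV[A]_n -> Prop) p a b :
  (forall u, S u -> wedge (vec_ext u) b = 0) ->
  wedge_span S p.+1 a -> wedge a b = 0.
Proof.
(* The induction passes through length 0, where it can only be claimed that the element is a
   scalar. *)
move=> Sb; suff gen p' a' : wedge_span S p' a' ->
    if p' is 0 then exists k, a' = k *: ext1 else wedge a' b = 0 by move/gen.
elim=> {p p' a a'} [k|p u a Su _ IHa|p a1 a2 _ IH1 _ IH2|p].
- by exists k.
- rewrite -wedgeA; case: p IHa => [[k ->]|p ->]; last by rewrite linear0.
  by rewrite wedgeZl wedge1l linearZ /= Sb // scaler0.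
- case: p IH1 IH2 => [[k1 ->] [k2 ->]|p IH1 IH2].
    by exists (k1 + k2); rewrite scalerDl.
  by rewrite wedgeDl IH1 IH2 addr0.
- by case: p => [|p]; [exists 0; rewrite scale0r|rewrite wedge0l].
Qed.

End WedgeProducts.

(** * Cancelling scalars over an integral domain *)

Section ScaleCancel.
Variables (A : idomainType) (n : nat).
Implicit Types (a b : ext A n).

Lemma scale_ext_eq0 (c : A) a : c != 0 -> c *: a = 0 -> a = 0.
Proof.
move=> nzc /ffunP ca0; apply/ffunP => J; have := ca0 J; rewrite !ffunE => /eqP.
by rewrite mulf_eq0 (negbTE nzc) => /eqP.
Qed.

(** A vanishing product passes from [a'] to [a] when they are proportional; only the coefficient of
    [a] is cancelled. *)
Lemma wedge_scale_eq0l (c k : A) a a' b :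
  c != 0 -> c *: a = k *: a' -> wedge a' b = 0 -> wedge a b = 0.
Proof.
move=> nzc eq_a a'b; apply: (scale_ext_eq0 nzc).
by rewrite -wedgeZl eq_a wedgeZl a'b scaler0.
Qed.

Lemma wedge_scale_eq0r (c k : A) a b b' :
  c != 0 -> c *: b = k *: b' -> wedge a b' = 0 -> wedge a b = 0.
Proof.
move=> nzc eq_b ab'; apply: (scale_ext_eq0 nzc).
by rewrite -wedgeZr eq_b wedgeZr ab' scaler0.
Qed.

End ScaleCancel.

(** * Algebra maps between exterior algebras *)

Section ExtMap.
Variables (B A : comNzRingType) (f : {rmorphism B -> A}) (m n : nat).
Variable g : 'I_m -> 'rV[A]_n.
Implicit Types (a b : ext B m) (J : {set 'I_m}).

(** The algebra map extending [f] and sending e_i to [g i]. It is given on the basis, so its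
    compatibility with products has to be proved. *)
Definition ext_map a : ext A n :=
  \sum_J f (a J) *: \big[@wedge A n/ext1]_(i in J) vec_ext (g i).

Definition vec_map (u : 'rV[B]_m) : 'rV[A]_n := \sum_i f (u 0 i) *: g i.

Lemma ext_map0 : ext_map 0 = 0.
Proof. by rewrite /ext_map big1 // => J _; rewrite ffunE rmorph0 scale0r. Qed.

Lemma ext_mapD a b : ext_map (a + b) = ext_map a + ext_map b.
Proof.
rewrite /ext_map -big_split; apply: eq_bigr => J _ /=.
by rewrite ffunE rmorphD scalerDl.
Qed.

Lemma ext_mapZ k a : ext_map (k *: a) = f k *: ext_map a.
Proof.
rewrite /ext_map scaler_sumr; apply: eq_bigr => J _.
by rewrite ffunE rmorphM scalerA.
Qed.

Lemma ext_mapN a : ext_map (- a) = - ext_map a.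
Proof. by rewrite -scaleN1r ext_mapZ rmorphN1 scaleN1r. Qed.

Lemma ext_map_sum I (r : seq I) P (F : I -> ext B m) :
  ext_map (\sum_(i <- r | P i) F i) = \sum_(i <- r | P i) ext_map (F i).
Proof. exact: (big_morph _ ext_mapD ext_map0). Qed.

Lemma ext_map_base J :
  ext_map (ext_base J) = \big[@wedge A n/ext1]_(i in J) vec_ext (g i).
Proof.
rewrite /ext_map (bigD1 J) //= big1 => [|L neL].
  by rewrite ffunE eqxx rmorph1 scale1r addr0.
by rewrite ffunE (negbTE neL) rmorph0 scale0r.
Qed.

Lemma ext_map_ext1 : ext_map ext1 = ext1.
Proof. by rewrite ext_map_base big_set0. Qed.

(** A sorted list makes induction possible: [g i] moves past the factors of smaller index, one sign
    each, to its place, or it meets itself and gives 0. *)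
Lemma wedge_insert_seq (r : seq 'I_m) i J :
  sorted (fun j k : 'I_m => j < k)%N r -> i \in r ->
  wedge (vec_ext (g i)) (\big[@wedge A n/ext1]_(j <- r | j \in J) vec_ext (g j))
    = if i \in J then 0 else
      (-1) ^+ count (fun j => (j \in J) && (j < i)%N) r *:
        \big[@wedge A n/ext1]_(j <- r | j \in i |: J) vec_ext (g j).
Proof.
have ltI_trans : transitive (fun j k : 'I_m => j < k)%N.
  by move=> k j l; apply: ltn_trans.
elim: r => // x r IHr /= px; have xr := order_path_min ltI_trans px.
have {}IHr := IHr (path_sorted px).
rewrite inE !big_cons !inE; case: (eqVneq i x) => [-> _|nix /= ir].
  rewrite ltnn andbF add0n orTb; case: ifP => xJ; first exact: wedge_vec_vecA.
  (* Here [i] is the head of the sorted list, so no smaller index occurs and the exponent is 0. *)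
  rewrite (_ : count _ r = 0%N) ?expr0 ?scale1r; last first.
    apply/eqP; rewrite -leqn0 leqNgt -has_count; apply/hasPn => j jr.
    by rewrite negb_and -leqNgt ltnW ?orbT // (allP xr).
  apply: (congr1 (wedge _)); rewrite big_seq_cond [RHS]big_seq_cond.
  apply: eq_bigl => j; rewrite !inE; case: (boolP (j \in r)) => //= jr.
  by case: eqVneq (allP xr j jr) => // ->; rewrite ltnn.
have xi : (x < i)%N by apply: (allP xr).
rewrite xi andbT /=; case: (x \in J) => /=; last exact: IHr.
rewrite wedge_vecCA IHr //; case: ifP => _; first by rewrite linear0 oppr0.
by rewrite linearZ /= exprS mulN1r scaleNr.
Qed.

Lemma wedge_insert i J :
  wedge (vec_ext (g i)) (\big[@wedge A n/ext1]_(j in J) vec_ext (g j))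
    = if i \in J then 0 else
      (-1) ^+ below i J *:
        \big[@wedge A n/ext1]_(j in i |: J) vec_ext (g j).
Proof.
rewrite wedge_insert_seq ?mem_index_enum //; last first.
  have := iota_ltn_sorted 0 m; rewrite -val_enum_ord sorted_map.
  by rewrite /index_enum -enumT.
rewrite /below -sum1_card -sum1_count; case: ifP => // _.
by congr (_ ^+ _ *: _); apply: eq_bigl => j; rewrite inE.
Qed.

(** Bilinearity reduces this to e_i and e_J, which is [wedge_insert]. Iterated, it handles
    decomposable elements. *)
Lemma ext_map_wedge_vec u a :
  ext_map (wedge (vec_ext u) a) = wedge (vec_ext (vec_map u)) (ext_map a).
Proof.
rewrite wedge_vecl ext_map_sum (linear_sum (@vec_ext A n)) wedge_suml.
apply: eq_bigr => i _; rewrite ext_mapZ (linearZZ (@vec_ext A n)) wedgeZl.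
 apply: (congr1 ( *:%R _)).
rewrite [a]ext_baseE wedge_sumr !ext_map_sum.
rewrite wedge_sumr; apply: eq_bigr => J _.
rewrite (linearZZ (wedge (ext_base _))) !ext_mapZ.
rewrite (linearZZ (wedge (vec_ext (g i)))); apply: (congr1 ( *:%R _)).
rewrite /= wedge_base wedge_sign1 ext_mapZ !ext_map_base.
rewrite wedge_insert.
by case: ifP => _; rewrite ?rmorph0 ?scale0r ?rmorph_sign.
Qed.

Lemma ext_map_big (s : seq 'rV[B]_m) :
  ext_map (\big[@wedge B m/ext1]_(u <- s) vec_ext u)
    = \big[@wedge A n/ext1]_(u <- map vec_map s) vec_ext u.
Proof.
elim: s => [|u s IHs]; first by rewrite !big_nil ext_map_ext1.
by rewrite /= !big_cons ext_map_wedge_vec IHs.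
Qed.

(** The hypothesis is the case of degree one. Both contractions are antiderivations, so it
    propagates along the product over [s]. *)
Lemma interior_ext_map (t : 'I_m -> B) (t' : 'I_n -> A) (k : A)
    (s : seq 'rV[B]_m) :
  (forall i, \sum_j g i 0 j * t' j = k * f (t i)) ->
  let a := \big[@wedge B m/ext1]_(u <- s) vec_ext u in
  interior t' (ext_map a) = k *: ext_map (interior t a).
Proof.
move=> gt' a; rewrite {}/a; elim: s => [|u s IHs].
  by rewrite big_nil ext_map_ext1 !interior_ext1 ext_map0 scaler0.
rewrite big_cons ext_map_wedge_vec !interior_vec_wedge IHs.
rewrite ext_mapD ext_mapN ext_mapZ ext_map_wedge_vec scalerBr linearZ /=.
congr (_ - _); rewrite scalerA; apply: (congr1 (fun k : A => k *: (_ : ext A n))).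
rewrite rmorph_sum mulr_sumr /vec_map.
under eq_bigr => j _ do rewrite summxE mulr_suml.
rewrite exchange_big; apply: eq_bigr => i _ /=.
rewrite rmorphM mulrCA -gt' mulr_sumr; apply: eq_bigr => j _.
by rewrite mxE mulrA.
Qed.

End ExtMap.

(** * Polynomial differential forms *)

Section DifferentialForms.
Variables (K : fieldType) (n : nat).
Local Notation pform := (ext {mpoly K[n]} n).
Implicit Types (f : {mpoly K[n]}) (a b w : pform) (J L : {set 'I_n}).

Lemma mderiv_homog e f i : f \is e.-homog -> f^`M(i) \is e.-1.-homog.
Proof.
move=> /dhomogP f_hom; rewrite [f]mpolyE linear_sum big_seq.
apply: rpred_sum => k /f_hom; rewrite /= => degk.
rewrite mderivZ mderivX; apply/rpredZ.
(* When x_i does not occur the derivative is 0, homogeneous of every degree; this covers e = 0,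
   where [e.-1] is truncated. *)
case: (posnP (k i)) => [->|ki]; first by rewrite scale0r rpred0.
apply: rpredZ; rewrite dhomogX -degk.
have ki' : (U_(i) <= k)%MM by rewrite lep1mP -lt0n.
by rewrite -{2}(submK ki') mdegD mdeg1 addn1.
Qed.

(** On a monomial, the derivative in x_i times x_i multiplies by the exponent of x_i, and the
    exponents add up to [e]. *)
Lemma euler_homog e f : f \is e.-homog ->
  \sum_i f^`M(i) * 'X_i = e%:R * f.
Proof.
move=> /dhomogP f_hom; rewrite [in LHS](mpolyE f) [in RHS](mpolyE f).
under eq_bigr => i _ do rewrite linear_sum mulr_suml.
rewrite exchange_big mulr_sumr big_seq [RHS]big_seq.
apply: eq_bigr => k /f_hom /= <-.
under eq_bigr => i _ do rewrite mderivZ -scalerAl.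
rewrite -scaler_sumr -scalerAr; congr (_ *: _).
rewrite mdegE natr_sum mulr_suml; apply: eq_bigr => i _.
rewrite mderivX -scalerAl; case: (posnP (k i)) => [->|ki].
  by rewrite scale0r mul0r.
have ki' : (U_(i) <= k)%MM by rewrite lep1mP -lt0n.
by rewrite -mpolyXD submK // scaler_nat mulr_natl.
Qed.

Definition coef_homog e w := forall J, (w J : {mpoly K[n]}) \is e.-homog.

Lemma coef_homog_sum e I (r : seq I) (P : pred I) (W : I -> pform) :
  (forall i, P i -> coef_homog e (W i)) ->
  coef_homog e (\sum_(i <- r | P i) W i).
Proof. by move=> hW J; rewrite sum_ffunE; apply: rpred_sum => i /hW. Qed.

Lemma coef_homogZ e e' f w :
  f \is e.-homog -> coef_homog e' w -> coef_homog (e + e') (f *: w).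
Proof. by move=> hf hw J; rewrite ffunE; apply: dhomogM. Qed.

Lemma coef_homog_base J : coef_homog 0 (ext_base J).
Proof.
by move=> L; rewrite ffunE; case: eqP => _; rewrite ?dhomog1 ?rpred0.
Qed.

Lemma coef_homog_wedge e e' a b :
  coef_homog e a -> coef_homog e' b -> coef_homog (e + e') (wedge a b).
Proof.
move=> ha hb; apply: coef_homog_sum => J _; apply: coef_homog_sum => L _.
rewrite -[(e + e')%N]addn0; apply: coef_homogZ; last exact: coef_homog_base.
by rewrite -mulrA -signr_odd mulr_sign; case: odd; rewrite ?rpredN; apply: dhomogM.
Qed.

(** A row vector, so that the results on products of [vec_ext] apply to differentials. *)
Definition grad f : 'rV[{mpoly K[n]}]_n := \row_i f^`M(i).

Lemma dfunE f : dfun f = vec_ext (grad f).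
Proof. by apply: eq_bigr => i _; rewrite mxE. Qed.

Lemma coef_homog_dfun e f : f \is e.-homog -> coef_homog e.-1 (dfun f).
Proof.
move=> hf; apply: coef_homog_sum => i _; rewrite -[e.-1]addn0.
by apply: coef_homogZ; [exact: mderiv_homog|exact: coef_homog_base].
Qed.

Lemma coef_homog_big (I : Type) (s : seq I) (P : pred I) (e : I -> nat)
    (W : I -> pform) :
  (forall i, coef_homog (e i) (W i)) ->
  coef_homog (\sum_(i <- s | P i) e i)%N
    (\big[@wedge {mpoly K[n]} n/ext1]_(i <- s | P i) W i).
Proof.
move=> hW; elim: s => [|i s IHs]; rewrite ?big_nil ?big_cons.
  exact: coef_homog_base.
by case: (P i) => //; apply: coef_homog_wedge.
Qed.

Lemma dfunM f h : dfun (f * h) = f *: dfun h + h *: dfun f.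
Proof.
rewrite !scaler_sumr -big_split; apply: eq_bigr => i _ /=.
by rewrite mderivM [_^`M(i) * h]mulrC !scalerA -scalerDl addrC.
Qed.

Lemma dfun1 : dfun (1 : {mpoly K[n]}) = 0.
Proof. by rewrite /dfun big1 // => i _; rewrite mderivC scale0r. Qed.

Lemma dfunM_wedge0 f h a :
  wedge (dfun f) a = 0 -> wedge (dfun h) a = 0 -> wedge (dfun (f * h)) a = 0.
Proof.
by move=> fa ha; rewrite dfunM; apply: wedge_comb0.
Qed.

Lemma dfun_prod_wedge (I : Type) (s : seq I) (P : pred I)
    (G : I -> {mpoly K[n]}) a :
  (forall i, P i -> wedge (dfun (G i)) a = 0) ->
  wedge (dfun (\prod_(i <- s | P i) G i)) a = 0.
Proof.
move=> Ga; elim: s => [|i s IHs].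
  by rewrite big_nil dfun1 wedge0l.
rewrite big_cons; case Pi: (P i); last exact: IHs.
exact: dfunM_wedge0 (Ga i Pi) IHs.
Qed.

(** * Partial derivatives of forms and the exterior derivative *)

Definition deriv_form i w : pform := [ffun J => (w J : {mpoly K[n]})^`M(i)].

Lemma deriv_formD i a b : deriv_form i (a + b) = deriv_form i a + deriv_form i b.
Proof. by apply/ffunP => J; rewrite !ffunE mderivD. Qed.

Lemma deriv_form0 i : deriv_form i 0 = 0.
Proof. by apply/ffunP => J; rewrite !ffunE mderiv0. Qed.

Lemma deriv_form_sum i I (r : seq I) P (W : I -> pform) :
  deriv_form i (\sum_(j <- r | P j) W j) = \sum_(j <- r | P j) deriv_form i (W j).
Proof. exact: (big_morph _ (deriv_formD i) (deriv_form0 i)). Qed.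

Lemma deriv_formZ i f w :
  deriv_form i (f *: w) = f^`M(i) *: w + f *: deriv_form i w.
Proof. by apply/ffunP => J; rewrite !ffunE mderivM. Qed.

Lemma deriv_form_base i J : deriv_form i (ext_base J) = 0.
Proof.
by apply/ffunP => L; rewrite !ffunE; case: eqP => _; rewrite ?mderiv0 ?mderivC.
Qed.

Lemma deriv_form_wedge i a b :
  deriv_form i (wedge a b) = wedge (deriv_form i a) b + wedge a (deriv_form i b).
Proof.
rewrite !wedgeE deriv_form_sum -big_split; apply: eq_bigr => J _ /=.
rewrite deriv_form_sum -big_split; apply: eq_bigr => L _ /=.
rewrite deriv_formZ deriv_form_base scaler0 addr0 !ffunE -scalerDl.
apply: (congr1 (fun k : {mpoly K[n]} => k *: (_ : pform))).
have ds : (wedge_sign {mpoly K[n]} J L)^`M(i) = 0.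
  rewrite /wedge_sign; case: ifP; rewrite ?mderiv0 // => _.
  by rewrite -signr_odd; case: odd; rewrite ?mderivN mderivC ?oppr0.
by rewrite !mderivM ds mul0r add0r.
Qed.

(** Exchanging the sums over index sets and variables isolates the partial derivatives, from whose
    rules those of d follow. *)
Lemma dformE w : dform w = \sum_i wedge (ext_base [set i]) (deriv_form i w).
Proof.
rewrite /dform; under eq_bigr => J _ do rewrite dfunE wedge_vecl.
rewrite exchange_big; apply: eq_bigr => i _ /=.
rewrite [deriv_form i w]ext_baseE wedge_sumr; apply: eq_bigr => J _.
by rewrite wedgeZr mxE ffunE.
Qed.

Lemma dform_sum I (r : seq I) P (W : I -> pform) :
  dform (\sum_(j <- r | P j) W j) = \sum_(j <- r | P j) dform (W j).
Proof.
rewrite dformE; under eq_bigr => i _ do rewrite deriv_form_sum wedge_sumr.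
by rewrite exchange_big; apply: eq_bigr => j _; rewrite dformE.
Qed.

Lemma dformZ f w : dform (f *: w) = wedge (dfun f) w + f *: dform w.
Proof.
rewrite !dformE dfunE wedge_vecl scaler_sumr -big_split.
apply: eq_bigr => i _ /=; rewrite mxE deriv_formZ linearD /=.
by rewrite !wedgeZr.
Qed.

(** Mixed partial derivatives are symmetric while products of two dx_i are antisymmetric. *)
Lemma dform_dfun f : dform (dfun f) = 0.
Proof.
rewrite dformE; under eq_bigr => i _.
  rewrite deriv_form_sum wedge_sumr.
  under eq_bigr => j _ do
    rewrite deriv_formZ deriv_form_base scaler0 addr0 wedgeZr.
  over.
apply: sum_alternating => [i|i j].
  by rewrite /= wedge_base1_base1 scaler0.
by rewrite /= wedge_base1_anti scalerN mderiv_comm.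
Qed.

Lemma dform_vec_wedge (u : 'rV[{mpoly K[n]}]_n) w :
  dform (wedge (vec_ext u) w)
    = wedge (dform (vec_ext u)) w - wedge (vec_ext u) (dform w).
Proof.
apply: etrans (dformE _) _.
apply: etrans (eq_bigr _ (fun i _ => congr1 (wedge _) (deriv_form_wedge i _ _))) _.
apply: etrans (sum_base1_leibniz _ _ _ _) _.
exact: (congr2 (fun x y => wedge x w - wedge (vec_ext u) y)
               (esym (dformE _)) (esym (dformE _))).
Qed.

Lemma dform_dfun_wedge f w :
  dform (wedge (dfun f) w) = - wedge (dfun f) (dform w).
Proof. by rewrite dfunE dform_vec_wedge -dfunE dform_dfun wedge0l add0r. Qed.

Lemma dform_big_dfun (I : Type) (s : seq I) (P : pred I) (G : I -> {mpoly K[n]}) :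
  dform (\big[@wedge {mpoly K[n]} n/ext1]_(i <- s | P i) dfun (G i)) = 0.
Proof.
elim: s => [|i s IHs]; rewrite ?big_nil ?big_cons.
  rewrite dformE big1 // => i _.
  by rewrite deriv_form_base (linear0 (wedge _)).
case: (P i); last exact: IHs.
by rewrite dform_dfun_wedge IHs (linear0 (wedge _)) oppr0.
Qed.

(** One term of F dw = dF /\ w: [f] and [h] are the products of the F_i inside and outside I, [l] is
    the constant lambda_I and [w] is dF_I. Since df kills dF_I, only dh contributes on either
    side. *)
Lemma dformZ_dfun_wedge f h l w :
  dfun l = 0 -> wedge (dfun f) w = 0 -> dform w = 0 ->
  (f * h) *: dform ((l * h) *: w) = wedge (dfun (f * h)) ((l * h) *: w).
Proof.
move=> dl fw dw; rewrite dformZ dw scaler0 addr0 !dfunM dl scaler0 addr0.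
exact: wedge_comb_scale.
Qed.

Lemma contractZ (v : ext K n) f w : contract v (f *: w) = f *: contract v w.
Proof.
rewrite /contract scaler_sumr; apply: eq_bigr => L _.
rewrite scalerA mulrC -scalerA; apply: (congr1 ( *:%R _)).
by elim: (enum L) w => // l s IHs w /=; rewrite linearZ /= IHs.
Qed.

(** Each basis multivector in [v] performs [q] contractions, and each of them removes one of the
    [q.+1] factors. *)
Lemma wedge_span_contract S q (v : ext K n) w :
  ext_degree q v -> wedge_span S q.+1 w -> wedge_span S 1 (contract v w).
Proof.
move=> degv Sw; apply: wedge_span_sum => L _.
have [->|/degv cardL] := eqVneq (v L) 0.
  by rewrite scale0r; apply: wedge_span_zero.
apply: wedge_spanZ; move: cardL; rewrite cardE.
elim: (enum L) q w Sw {degv} => [|l s IHs] [|q] w Sw //= [sq].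
exact/(IHs q)/sq/(wedge_span_interior _ Sw).
Qed.

End DifferentialForms.

(** * Logarithmic forms *)

Section LogarithmicForms.
Variables (K : fieldType) (q m n : nat).
Variables (lam : ext K m) (F : 'I_m -> {mpoly K[n.+1]}).
Local Notation A := {mpoly K[n.+1]}.
Local Notation w := (log_form q lam F).
Local Notation Fprod := (\prod_j F j).

(** F dF_i / F_i with the denominator cleared: the image of e_i under phi. *)
Definition log_vec (i : 'I_m) : 'rV[A]_n.+1 :=
  (\prod_(j | j != i) F j) *: grad (F i).

Lemma prod_split (I : {set 'I_m}) :
  Fprod = \prod_(i in I) F i * \prod_(i | i \notin I) F i.
Proof. by rewrite (bigID (mem I)). Qed.

(** For each i in I, one factor of F^q is split as F_i times the product of the other F_j; these F_i
    recombine with the complementary product into the F on the right. Neither division nor an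
    exponent q - 1 occurs. *)
Lemma log_form_ext_map : ext_degree q lam ->
  Fprod ^+ q *: w = Fprod *: ext_map (@mpolyC n.+1 K) log_vec lam.
Proof.
move=> deg_lam; rewrite /log_form /ext_map.
rewrite [LHS]scaler_sumr [RHS]scaler_sumr [LHS]big_mkcond.
apply: eq_bigr => I _; case: eqP => [cardI|neI]; last first.
  (* Such I occur in phi(lam) but not in [w]; their coefficients are 0 by the degree of [lam]. *)
  have [->|/deg_lam//] := eqVneq (lam I) 0.
  by rewrite rmorph0 scale0r scaler0.
have -> : \big[@wedge A n.+1/ext1]_(i in I) vec_ext (log_vec i)
    = (\prod_(i in I) \prod_(j | j != i) F j) *:
        \big[@wedge A n.+1/ext1]_(i in I) dfun (F i).
  apply: etrans (big_wedgeZ _ _ _ _) _; apply: (congr1 ( *:%R _)).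
  by apply: eq_bigr => i _; rewrite dfunE.
move: (\big[_/_]_(i in I) dfun (F i)) => W; rewrite !scalerA.
apply: (congr1 (fun k : A => k *: W)).
rewrite -{1}cardI -prodr_const.
rewrite (eq_bigr (fun i => F i * \prod_(j | j != i) F j)); last first.
  by move=> i _; rewrite (bigD1 i).
rewrite big_split [in RHS](prod_split I) /=.
have comm4 (x h l y : A) : x * h * (l * y) = x * y * l * h.
  by rewrite mulrACA [h * y]mulrC mulrA [x * l * y]mulrAC.
exact: comm4.
Qed.

Lemma dfun_wedge_big i (I : {set 'I_m}) : i \in I ->
  wedge (dfun (F i)) (\big[@wedge A n.+1/ext1]_(j in I) dfun (F j)) = 0.
Proof.
move=> iI; under eq_bigr do rewrite dfunE.
by rewrite dfunE (wedge_insert (fun i => grad (F i))) iI.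
Qed.

(** Term by term: dF_I is closed, and it is killed by dF_i for every i in I. *)
Lemma dform_log_form : Fprod *: dform w = wedge (dfun Fprod) w.
Proof.
rewrite dform_sum scaler_sumr wedge_sumr; apply: eq_bigr => I _.
rewrite [in LHS](prod_split I) [in RHS](prod_split I).
apply: dformZ_dfun_wedge.
- by rewrite /dfun big1 // => i _; rewrite mderivC scale0r.
- by apply: dfun_prod_wedge => i; apply: dfun_wedge_big.
- exact: dform_big_dfun.
Qed.

(** The zero sits in the complementary product when i is not in I, and in dF_I otherwise. This
    settles the case where F cannot be cancelled. *)
Lemma log_form_eq0 i : F i = 0 -> w = 0.
Proof.
move=> Fi0; rewrite /log_form big1 // => I _.
case: (boolP (i \in I)) => iI; last first.
  by rewrite (bigD1 i) //= Fi0 mul0r mulr0 scale0r.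
under [X in _ *: X]eq_bigr do rewrite dfunE.
rewrite (big_wedge0 (i := i)) ?scaler0 ?mem_index_enum //.
by apply/rowP => j; rewrite Fi0 !mxE mderiv0.
Qed.

Lemma ext_degree_log_form : ext_degree q w.
Proof.
apply: ext_degree_sum => I /eqP <-; apply: ext_degreeZ.
under eq_bigr do rewrite dfunE; rewrite -sum1_card sum1_count.
exact: ext_degree_big.
Qed.

(** Each F_i outside I contributes d_i and each differential inside I contributes d_i - 1, not
    truncated as d_i > 0. *)
Lemma coef_homog_log_form (dd : 'I_m -> nat) :
  (forall i, (0 < dd i)%N) -> (forall i, F i \is (dd i).-homog) ->
  coef_homog (\sum_i dd i - q)%N w.
Proof.
move=> dd_gt0 F_homog; apply: coef_homog_sum => I /eqP cardI.
rewrite (_ : (_ - _)%N = \sum_(i | i \notin I) dd i + \sum_(i in I) (dd i).-1)%N.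
  apply: coef_homogZ; last by apply: coef_homog_big => i; apply: coef_homog_dfun.
  rewrite mul_mpolyC; apply: rpredZ.
  apply: (big_ind2 (fun (f : A) e => f \is e.-homog)) => //.
    exact: dhomog1.
  by move=> f e f' e'; apply: dhomogM.
rewrite (bigID (mem I)) /= addnC.
rewrite [X in (_ + X - _)%N](_ : _ = \sum_(i in I) (dd i).-1 + q)%N.
  by rewrite addnA addnK.
rewrite -cardI -sum1_card -big_split; apply: eq_bigr => i _ /=.
by rewrite addn1 prednK.
Qed.

(** Euler's identity for F_i times the other factors; it provides the hypothesis of
    [interior_ext_map] with [k] equal to F. *)
Lemma interior_euler_log_vec (dd : 'I_m -> nat) :
  (forall i, F i \is (dd i).-homog) ->
  forall i, \sum_j log_vec i 0 j * 'X_j = Fprod * ((dd i)%:R : K)%:MP.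
Proof.
move=> F_homog i; under [LHS]eq_bigr do rewrite !mxE -mulrA.
rewrite -mulr_sumr (euler_homog (F_homog i)) [in RHS](bigD1 i) //= mpolyC_nat.
by rewrite mulrCA mulrC [F i * _]mulrC.
Qed.

End LogarithmicForms.

(** * Decomposable coefficients: Euler contraction and foliation equations *)

Section PluckerLogForms.
Variables (K : fieldType) (q m n : nat) (b : q.-tuple 'rV[K]_m).
Variable F : 'I_m -> {mpoly K[n.+1]}.
Hypothesis F_neq0 : forall i, F i != 0.
Local Notation A := {mpoly K[n.+1]}.
Local Notation lam := (\big[@wedge K m/ext1]_(u <- b) vec_ext u).
Local Notation w := (log_form q lam F).
Local Notation Fprod := (\prod_j F j).

Lemma Fprod_neq0 : Fprod != 0.
Proof. by apply/prodf_neq0 => i _; apply: F_neq0. Qed.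

Lemma ext_degree_lam : ext_degree q lam.
Proof.
have := @ext_degree_big K m _ b xpredT id.
by rewrite count_predT size_tuple.
Qed.

Let scaled : Fprod ^+ q *: w = Fprod *:
  \big[@wedge A n.+1/ext1]_(u <- map (vec_map (@mpolyC n.+1 K) (log_vec F)) b)
     vec_ext u.
Proof. by rewrite log_form_ext_map ?ext_map_big //; apply: ext_degree_lam. Qed.

Lemma interior_log_form (dd : 'I_m -> nat) :
  (forall i, F i \is (dd i).-homog) ->
  interior (fun i => (dd i)%:R) lam = 0 ->
  interior (fun i => 'X_i) w = 0.
Proof.
move=> F_homog lam0; have nzF := Fprod_neq0.
apply: (scale_ext_eq0 (expf_neq0 q nzF)).
rewrite -interiorZ log_form_ext_map; last exact: ext_degree_lam.
rewrite interiorZ.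
rewrite (interior_ext_map b (interior_euler_log_vec F_homog)).
by rewrite lam0 ext_map0 !scaler0.
Qed.

Lemma foliation_log_form : (0 < q)%N -> foliation_equations q w.
Proof.
move=> q_gt0 v degv; have nzF := Fprod_neq0; have nzFq := expf_neq0 q nzF.
move: scaled; set s := map _ _; set th := \big[_/_]_(u <- s) _ => scaled_w.
(* [th] is phi(lam), a product of q vectors, so q - 1 contractions leave a combination of single
   vectors. *)
have th_span : wedge_span (fun u => u \in s) 1 (contract v th).
  apply: (wedge_span_contract degv); rewrite prednK //.
  have := @wedge_span_big _ _ (fun u => u \in s) s (fun u su => su).
  by rewrite size_map size_tuple.
have cw : Fprod ^+ q *: contract v w = Fprod *: contract v th.
  by rewrite -!contractZ scaled_w.
have sth u : u \in s -> wedge (vec_ext u) th = 0 by exact: wedge_vec_big.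
(* Each vector of [s] kills [th], hence so does [contract v th]; cancelling F^q replaces [th] by
   [w]. *)
have w0 : wedge (contract v th) w = 0.
  exact: wedge_scale_eq0r nzFq scaled_w (wedge_span_wedge0 sth th_span).
split; apply: (wedge_scale_eq0l nzFq cw _); first exact: w0.
(* F dw = dF /\ w, and a vector of [s] kills this too: it passes dF up to sign and kills [w]. *)
apply: (wedge_scale_eq0r nzF (k := 1) (b' := wedge (dfun Fprod) w)).
  by rewrite dform_log_form scale1r.
apply: (wedge_span_wedge0 _ th_span) => u su; rewrite dfunE.
exact: wedge_vec_wedge0 (wedge_scale_eq0r nzFq scaled_w (sth u su)).
Qed.

End PluckerLogForms.

(** * Irreducibility of projective space *)

Section ProjectiveSpace.
Variables (K : numFieldType) (n : nat).
Local Notation point := (proj_space K n).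
Implicit Types (f g : {mpoly K[n.+1]}) (u v : 'rV[K]_n.+1).

Lemma poly_nonroot (p : {poly K}) : p != 0 -> exists t, p.[t] != 0.
Proof.
(* [size p] points, one more than the degree; they are distinct in characteristic 0. *)
move=> p0; pose s : seq K := [seq k%:R | k <- iota 0 (size p)].
have us : uniq s.
  rewrite map_inj_uniq ?iota_uniq // => i j /eqP.
  by rewrite Num.Theory.eqr_nat => /eqP.
have /allPn[t _ nt] : ~~ all (root p) s.
  apply/negP => rs; have := max_poly_roots p0 rs us.
  by rewrite size_map size_iota ltnn.
by exists t.
Qed.

(** The restriction of [f] to the line through [u] and [v], at parameters 0 and 1. *)
Definition line_poly u v f : {poly K} :=
  mmap (@polyC K) (fun i => (u 0 i)%:P + (v 0 i - u 0 i) *: 'X) f.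

Lemma line_polyE u v f t :
  (line_poly u v f).[t] = f.@[fun i => (u + t *: (v - u)) 0 i].
Proof.
rewrite /line_poly /meval /mmap horner_sum; apply: eq_bigr => k _.
rewrite hornerM hornerC horner_prod; congr (_ * _); apply: eq_bigr => i _.
by rewrite horner_exp !hornerE !mxE mulrC.
Qed.

(* On the line through u and v both f and g restrict to nonzero univariate
   polynomials. *)
Lemma exists_common_nonzero u v f g :
  u != 0 -> f.@[fun i => u 0 i] != 0 -> g.@[fun i => v 0 i] != 0 ->
  exists y : 'rV[K]_n.+1,
    [/\ y != 0, f.@[fun i => y 0 i] != 0 & g.@[fun i => y 0 i] != 0].
Proof.
move=> /rV0Pn[i ui] fu gv.
(* The third factor, a coordinate not vanishing at [u], keeps the chosen point away from the
   origin. *)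
pose p := line_poly u v f * line_poly u v g * line_poly u v 'X_i.
have nz h t : (line_poly u v h).[t] != 0 -> line_poly u v h != 0.
  by apply: contra_neq => ->; rewrite horner0.
have [t] : exists t, p.[t] != 0.
  apply: poly_nonroot; rewrite !mulf_neq0 //.
  - by apply: (nz _ 0); rewrite line_polyE scale0r addr0.
  - by apply: (nz _ 1); rewrite line_polyE scale1r addrC subrK.
  - by apply: (nz _ 0); rewrite line_polyE scale0r addr0 mevalXU.
rewrite !hornerM !mulf_eq0 !negb_or !line_polyE mevalXU -andbA.
case/and3P=> ft gt it; exists (u + t *: (v - u)); split=> //.
by apply/rV0Pn; exists i.
Qed.

Lemma dim_line_eq1 u : u != 0 -> \dim <[u]> == 1%N.
Proof. by move=> nz; rewrite dim_vline nz. Qed.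

Definition line_point u (nzu : u != 0) : point :=
  exist (fun W : {vspace 'rV[K]_n.+1} => \dim W == 1%N) <[u]>%VS (dim_line_eq1 nzu).

(** Each of two proper closed subsets has an equation that is nonzero somewhere; a point where both
    equations are nonzero lies outside the union. *)
Lemma irreducible_setT : irreducible_closed [set: point]%classic.
Proof.
split.
- by exists classical_sets.set0 => //; apply/seteqP; split=> // p _ f.
- have nz : const_mx 1 != 0 :> 'rV[K]_n.+1.
    by apply/rV0Pn; exists 0; rewrite mxE oner_neq0.
  by exists (line_point nz).
move=> _ _ [T1 hT1 ->] [T2 hT2 ->] cover.
have missed (T : set {mpoly K[n.+1]}) :
    ~ ([set: point] `<=` [set p | forall f, T f -> vanishes f p])%classic ->
    exists f u, [/\ T f, u != 0 & f.@[fun i => u 0 i] != 0].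
  move=> nsub; apply: contrapT => none; apply: nsub => p _ f Tf u up nzu.
  by apply/eqP; apply: contrapT => /negP nfu; apply: none; exists f, u.
apply: contrapT => /not_orP[/missed[f [u [Tf nzu fu]]] /missed[g [v [Tg _ gv]]]].
have [y [nzy fy gy]] := exists_common_nonzero nzu fu gv.
have yl : y \in val (line_point nzy) by apply: memv_line.
by case: (cover (line_point nzy) I) => [/(_ f Tf y yl nzy)|/(_ g Tg y yl nzy)] /eqP;
  apply/negP.
Qed.

(** Tested on the whole space, the condition would give a set strictly containing it at the first
    step of the chain. *)
Lemma codim_ge_setTN k : ~ codim_ge k.+1 [set: point]%classic.
Proof.
move=> /(_ _ irreducible_setT (fun _ x => x))[c [c0 _ /(_ 0%N isT)]].
by rewrite c0 => -[_ nsub]; apply: nsub.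
Qed.

Lemma sing0 : sing (0 : ext {mpoly K[n.+1]} n.+1) = [set: point]%classic.
Proof.
by apply/seteqP; split=> // p _ J u _ _; rewrite ffunE meval0.
Qed.

End ProjectiveSpace.

(** * Conclusion over the complex numbers *)

Local Open Scope complex_scope.

Theorem proposition2p17 (R : realType) (q n m d : nat)
  (q_ge1 : (1 <= q)%N) (n_gt_q : (q < n)%N) (m_ge : (q.+1 <= m)%N)
  (d_gt_q : (q < d)%N)
  (dd : 'I_m -> nat) (dd_gt0 : forall i, (0 < dd i)%N)
  (sum_dd : (\sum_(i < m) dd i)%N = d)
  (Lam : Gr R[i] q m) (lam : ext R[i] m) (lamP : plucker Lam lam)
  (lam_dd : interior (fun i => (dd i)%:R) lam = 0)
  (F : 'I_m -> {mpoly R[i][n.+1]}) (F_homog : forall i, F i \is (dd i).-homog) :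
  let w := log_form q lam F in
  [/\ twisted_form q d w,
      forall v : ext R[i] n.+1, ext_degree q.-1 v ->
        wedge (contract v w) w = 0 /\ wedge (contract v w) (dform w) = 0 &
      codim_ge 2 (sing w) -> foliations R[i] n q d (proj_class w)].
Proof.
move=> w; have [b _ lamE] := lamP.
(* Cancelling F requires every [F i] to be nonzero, so the case of a zero [F i] is treated apart. *)
have [F_neq0|/existsNP[i /negP/negPn/eqP Fi0]] :=
  pselect (forall i, F i != 0); last first.
  have w0 : w = 0 by apply: log_form_eq0 Fi0.
  have cw v : contract v w = 0.
    rewrite w0 -[0 in LHS](scale0r (0 : ext {mpoly R[i][n.+1]} n.+1)).
    by rewrite contractZ scale0r.
  (* The zero form vanishes on all of P^n, so the codimension assumption fails and the last claim is
     vacuous. *)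
  split=> [|v _|]; last by rewrite w0 sing0 => /codim_ge_setTN.
    rewrite w0; split; first by move=> J; rewrite ffunE eqxx.
      by move=> J; rewrite ffunE rpred0.
    exact: (linear0 (interior _)).
  by rewrite cw !wedge0l.
have tw : twisted_form q d w.
  split; first exact: ext_degree_log_form.
    by rewrite -sum_dd; apply: coef_homog_log_form.
  by move: lam_dd; rewrite /w lamE; apply: interior_log_form.
have fw : foliation_equations q w by rewrite /w lamE; apply: foliation_log_form.
split=> // cod; exists w; split=> //; split=> //.
(* A projective class needs [w] nonzero, and the codimension assumption excludes the zero form. *)
by apply/eqP => w0; move: cod; rewrite w0 sing0 => /codim_ge_setTN.
Qed.
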